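(* Let $f:\mathbb{R}^n\to\mathbb{R}$ be twice continuously differentiable with $\gamma$-Lipschitz continuous Hessian, and let $x_*$ be a minimizer of $f$. Let $\{x_t\}_{t\ge0}$ be generated by Algorithm INCR with $\eta_t=\gamma$ for all $t\ge0$. Assume that \[ 0\preceq H_t-\nabla^2 f(x_t)\preceq \mu_t I\qquad\forall t\ge0, \] where $0\le\mu_t\le\mu_u$ for some $\mu_u\ge0$, and that the level set $\mathcal{S}=\{x: f(x)\le f(x_0)\}$ satisfies $\max_{x,x'\in\mathcal{S}}\|x-x'\|\le R$ for some $R>0$. (a) If $f$ is strongly convex with parameter $\lambda>0$, then for any $t\ge0$, \[ f(x_t)-f(x_* )\le(1-\bar\alpha)^t\,(f(x_0)-f(x_* )),\qquad \bar\alpha=\min\left\{\frac13,\ \frac{\lambda}{6\mu_u},\ \sqrt{\frac{2\lambda}{\gamma R}}\right\}. \] (b) If $f$ is only convex, then for any $t\ge1$, \[ f(x_t)-f(x_* )\le\frac{9\mu_uR^2}{2(t+2)}+\frac{3\gamma R^3}{(t+1)(t+2)}. \]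
   Context: $\|\cdot\|$ is the Euclidean norm for vectors and the spectral norm for matrices; $\preceq$ is the Loewner order. The Hessian of $f$ is $\gamma$-Lipschitz if $\|\nabla^2 f(x)-\nabla^2 f(x')\|\le\gamma\|x-x'\|$ for all $x,x'$. The function $f$ is strongly convex with parameter $\lambda\ge0$ if $f(\alpha x+(1-\alpha)x')\le\alpha f(x)+(1-\alpha)f(x')-\frac{\alpha(1-\alpha)\lambda}{2}\|x-x'\|^2$ for all $x,x'\in\mathbb{R}^n$, $\alpha\in[0,1]$; ''only convex'' means $\lambda=0$. In a minimum, a term with zero denominator is read as $+\infty$. Algorithm INCR (inexact Newton method with cubic regularization): given $x_0\in\mathbb{R}^n$ and a nonnegative sequence $\{\eta_t\}_{t\ge0}$, for $t=0,1,2,\dots$ choose a symmetric matrix $H_t\in\mathbb{R}^{n\times n}$ (an approximation of $\nabla^2 f(x_t)$) and let \[ x_{t+1}=\arg\min_{x\in\mathbb{R}^n}\tilde f_{\eta_t}(x;x_t),\qquad \tilde f_{\eta_t}(x;x_t)=f(x_t)+\langle\nabla f(x_t),x-x_t\rangle+\tfrac12\langle H_t(x-x_t),x-x_t\rangle+\tfrac{\eta_t}{6}\|x-x_t\|^3 . \] *)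

(* Defs.v *)
(* MathComp-Analysis *)
From HB Require Import structures.
From mathcomp Require Import all_boot all_order all_algebra.
From mathcomp Require Import all_classical all_reals all_analysis.

Set Implicit Arguments.
Unset Strict Implicit.
Unset Printing Implicit Defensive.

Import Order.TTheory GRing.Theory Num.Theory.
Import numFieldNormedType.Exports.

Local Open Scope classical_set_scope.
Local Open Scope ring_scope.

(* Vectors of R^n are row vectors, since the library's Jacobian acts on rows;
   a matrix A thus acts by v |-> v *m A.  The library norm `|v| on 'rV[R]_n is
   the max norm: it is used here only through the topology it induces, never
   as a quantity. *)

Definition dotv (R : realType) (n : nat) (u v : 'rV[R]_n) : R :=
  (u *m v^T) 0 0.

Definition enorm (R : realType) (n : nat) (v : 'rV[R]_n) : R :=
  Num.sqrt (dotv v v).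

(* A and A^T have the same spectral norm, so the side on which A acts does not
   matter. *)
Definition specnorm (R : realType) (n : nat) (A : 'M[R]_n) : R :=
  sup [set enorm (v *m A) | v in [set v : 'rV[R]_n | enorm v <= 1]].

(* To be used on symmetric matrices only: symmetry is not part of it. *)
Definition loewner_le (R : realType) (n : nat) (A B : 'M[R]_n) : Prop :=
  forall v : 'rV[R]_n, 0 <= dotv (v *m (B - A)) v.

Definition grad (R : realType) (n : nat) (f : 'rV[R]_n -> R) (x : 'rV[R]_n) :
    'rV[R]_n :=
  \row_(j < n) 'D_(delta_mx 0 j) f x.

(* The entry (i, j) is the derivative along e_i of the partial derivative of f
   along e_j. *)
Definition hess (R : realType) (n : nat) (f : 'rV[R]_n -> R) (x : 'rV[R]_n) :
    'M[R]_n :=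
  'J (grad f) x.

Definition twice_cont_diff (R : realType) (n : nat) (f : 'rV[R]_n -> R) :
    Prop :=
  [/\ forall x, differentiable f x,
      forall x, differentiable (grad f) x
    & continuous (hess f)].

Definition lipschitz_hess (R : realType) (n : nat) (gamma : R)
    (f : 'rV[R]_n -> R) : Prop :=
  forall x x' : 'rV[R]_n,
    specnorm (hess f x - hess f x') <= gamma * enorm (x - x').

Definition strongly_convex (R : realType) (n : nat) (lambda : R)
    (f : 'rV[R]_n -> R) : Prop :=
  forall (x x' : 'rV[R]_n) (alpha : R), 0 <= alpha <= 1 ->
    f (alpha *: x + (1 - alpha) *: x') <=
      alpha * f x + (1 - alpha) * f x'
      - alpha * (1 - alpha) * lambda / 2 * enorm (x - x') ^+ 2.

Definition is_minimizer (R : realType) (n : nat) (g : 'rV[R]_n -> R)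
    (z : 'rV[R]_n) : Prop :=
  forall y : 'rV[R]_n, g z <= g y.

Definition cubic_model (R : realType) (n : nat) (f : 'rV[R]_n -> R) (eta : R)
    (H : 'M[R]_n) (xt x : 'rV[R]_n) : R :=
  f xt + dotv (grad f xt) (x - xt)
  + 2^-1 * dotv ((x - xt) *m H) (x - xt)
  + eta / 6 * enorm (x - xt) ^+ 3.

(* [x] is a run of the method started at [x 0], with regularization parameters
   [eta] and Hessian approximations [H]. *)
Definition INCR (R : realType) (n : nat) (f : 'rV[R]_n -> R) (eta : nat -> R)
    (H : nat -> 'M[R]_n) (x : nat -> 'rV[R]_n) : Prop :=
  forall t : nat,
    [/\ 0 <= eta t,
        (H t)^T = H t
      & is_minimizer (cubic_model f (eta t) (H t) (x t)) (x t.+1)].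

(* In extended reals 0^-1 = +oo and sqrte +oo = +oo, so for lambda > 0 a term
   with zero denominator is +oo. *)
Definition alpha_bar (R : realType) (lambda mu_u gamma rad : R) : R :=
  fine (Order.min (3^-1)%:E
         (Order.min (lambda%:E / (6 * mu_u)%:E)
                    (sqrte ((2 * lambda)%:E / (gamma * rad)%:E))))%E.

(* Main.v *)
Require Import Defs.
From HB Require Import structures.
From mathcomp Require Import all_boot all_order all_algebra.
From mathcomp Require Import all_classical all_reals all_analysis.
From mathcomp Require Import ring lra.
Set Implicit Arguments.
Unset Strict Implicit.
Unset Printing Implicit Defensive.
Import Order.TTheory GRing.Theory Num.Theory.
Import numFieldNormedType.Exports.
Local Open Scope ring_scope.

(** Let z be the minimizer, x and y = x + d two consecutive iterates, m the
    cubic model at x, and write D = |z - x|, W = |z - y|, r = |d|,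
    delta = f x - f z and delta' = f y - f z. Since the Hessian is Lipschitz and
    H dominates it, m is an upper bound for f, and at x + v it exceeds f by at
    most mu |v|^2 / 2 + gamma |v|^3 / 3. The usual argument compares
    f y <= m y with m at x + a (z - x) and uses convexity there, which gives
      delta' <= (1 - a) delta + mu a^2 D^2 / 2 + gamma a^3 D^3 / 3.
    This recursion is too weak for the constants of the theorem: in the convex
    case with mu = 0, for instance, it only yields a rate of 9 gamma R^3 / t^2.
    Two losses in it are recovered.

    First, y minimizes m exactly, so m grows away from y at least like the
    Bregman divergence of the cubic term. In [model_step_le] this replaces
    a^3 D^3 / 3 by a^3 D^3 / 6 - r^3 / 3 + r a <d, z - x> / 2, which is a gain
    unless d points at z with the right length. Moreover
    <d, z - x> = (D^2 + r^2 - W^2) / 2, so a step that points at z brings the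
    iterate closer to z.

    Second, m y is larger than f y when y is far from optimal. Beyond y, at
    y - b (z - y), convexity makes f large, f is below m, and m is still close to
    its minimum m y; [model_step_ge] turns this into
    m y - f y >= b delta' - mu b^2 W^2 / 2 - gamma (r b^2 W^2 + b^3 W^3 / 3).

    For the linear rate with factor 1 - A, both bounds are used with weights a
    and b proportional to A and chosen such that delta cancels
    ([contraction_step]). What remains is a polynomial inequality that fails for
    A close to 1/3 if D is as large as R; but strong convexity prevents this,
    since the level set also extends behind the minimizer: [level_diam_gap]
    gives D (1 + 6 A / 5) <= R.

    For the sublinear rate, the steps along which the two bounds are weakest
    point at z and hence decrease D, so the distance is put into the
    induction hypothesis: for t >= 1,
      delta_t <= 9 mu R^2 / (2 (t + 2))
                 + gamma R (3 R^2 - 3 D_t^2 / 5) / ((t + 1) (t + 2)).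
    With weights of order 1 / t this is reproduced by each step
    ([potential_step]), and the parts in mu and in gamma decouple. *)

(** * Euclidean norm and spectral norm *)

Section Euclid.
Context {R : realType} {n : nat}.
Implicit Types (u v w : 'rV[R]_n) (A : 'M[R]_n).

Lemma dotvE u v : dotv u v = \sum_j u 0 j * v 0 j.
Proof. by rewrite /dotv mxE; apply: eq_bigr => j _; rewrite mxE. Qed.

Lemma dotvC u v : dotv u v = dotv v u.
Proof. by rewrite !dotvE; apply: eq_bigr => j _; rewrite mulrC. Qed.

Lemma dotvDl u v w : dotv (u + v) w = dotv u w + dotv v w.
Proof. by rewrite /dotv mulmxDl mxE. Qed.

Lemma dotvZl a u v : dotv (a *: u) v = a * dotv u v.
Proof. by rewrite /dotv -scalemxAl mxE. Qed.

Lemma dotvNl u v : dotv (- u) v = - dotv u v.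
Proof. by rewrite /dotv mulNmx mxE. Qed.

Lemma dotvDr u v w : dotv u (v + w) = dotv u v + dotv u w.
Proof. by rewrite dotvC dotvDl !(dotvC u). Qed.

Lemma dotvZr a u v : dotv u (a *: v) = a * dotv u v.
Proof. by rewrite dotvC dotvZl dotvC. Qed.

Lemma dotvNr u v : dotv u (- v) = - dotv u v.
Proof. by rewrite dotvC dotvNl dotvC. Qed.

Lemma dotvv_ge0 u : 0 <= dotv u u.
Proof. by rewrite dotvE sumr_ge0 // => j _; rewrite -expr2 sqr_ge0. Qed.

Lemma enorm_ge0 u : 0 <= enorm u. Proof. exact: sqrtr_ge0. Qed.

Lemma enorm2 u : enorm u ^+ 2 = dotv u u.
Proof. by rewrite sqr_sqrtr // dotvv_ge0. Qed.

Lemma enormZ a u : enorm (a *: u) = `|a| * enorm u.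
Proof.
by rewrite /enorm dotvZl dotvZr mulrA -expr2 sqrtrM ?sqr_ge0 // sqrtr_sqr.
Qed.

Lemma enormN u : enorm (- u) = enorm u.
Proof. by rewrite /enorm dotvNl dotvNr opprK. Qed.

Lemma cauchy_schwarz u v : `|dotv u v| <= enorm u * enorm v.
Proof.
rewrite -(ler_pXn2r (n := 2)) ?nnegrE ?mulr_ge0 ?enorm_ge0 //.
rewrite real_normK ?num_real // exprMn !enorm2.
have := dotvv_ge0 (dotv v v *: u - dotv u v *: v).
rewrite !(dotvDl, dotvDr, dotvNl, dotvNr, dotvZl, dotvZr) (dotvC v u).
have := dotvv_ge0 v; rewrite le_eqVlt => /orP[/eqP v0 _|v_gt0 h].
  suff -> : v = 0 by rewrite /dotv trmx0 !mulmx0 !mxE expr0n /= mulr0.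
  apply/rowP => j; rewrite mxE; apply/eqP; rewrite -sqrf_eq0.
  move/esym/eqP: v0; rewrite dotvE psumr_eq0 => [/allP/(_ j)|i _].
    by rewrite mem_index_enum -expr2 => /(_ isT).
  by rewrite -expr2 sqr_ge0.
rewrite -(ler_pM2l v_gt0); nra.
Qed.

Lemma dotv_le u v : dotv u v <= enorm u * enorm v.
Proof. exact: le_trans (ler_norm _) (cauchy_schwarz u v). Qed.

Lemma enormD u v : enorm (u + v) <= enorm u + enorm v.
Proof.
rewrite -(ler_pXn2r (n := 2)) ?nnegrE ?addr_ge0 ?enorm_ge0 //.
rewrite sqrrD !enorm2 dotvDl !dotvDr (dotvC v u).
have := dotv_le u v; lra.
Qed.

Lemma enormBC u v : enorm (u - v) = enorm (v - u).
Proof. by rewrite -opprB enormN. Qed.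

Lemma enorm_mulmx_bounded A :
  exists M, forall v, enorm v <= 1 -> enorm (v *m A) <= M.
Proof.
exists (\sum_i enorm (row i A)) => v v1.
suff : enorm (v *m A) <= enorm v * \sum_i enorm (row i A).
  move=> h; apply: (le_trans h); rewrite ler_piMl // sumr_ge0 // => i _.
  exact: enorm_ge0.
rewrite mulmx_sum_row mulr_sumr.
have : forall i, enorm (v 0 i *: row i A) <= enorm v * enorm (row i A).
  move=> i; rewrite enormZ ler_wpM2r ?enorm_ge0 //.
  rewrite -(ler_pXn2r (n := 2)) ?nnegrE ?enorm_ge0 //.
  rewrite real_normK ?num_real // enorm2 dotvE (bigD1 i) //= -expr2 lerDl.
  by rewrite sumr_ge0 // => j _; rewrite -expr2 sqr_ge0.
move=> hi; elim/big_ind2: _ => [|x1 x2 y1 y2 h1 h2|i _]; last exact: hi.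
  by rewrite /enorm /dotv mul0mx mxE sqrtr0.
exact: le_trans (enormD _ _) (lerD h1 h2).
Qed.

(** On a vector of norm 0 the bound cannot be obtained by normalizing; there
    every multiple of [v] stays in the unit ball, whose image is bounded. *)
Lemma specnorm_le v A : enorm (v *m A) <= specnorm A * enorm v.
Proof.
have [v0|v0] := eqVneq (enorm v) 0.
  have [M hM] := enorm_mulmx_bounded A.
  have z : forall k : nat, k%:R * enorm (v *m A) <= M.
    move=> k; have := hM (k%:R *: v); rewrite enormZ v0 mulr0 ler01 => /(_ isT).
    by rewrite -scalemxAl enormZ normr_nat.
  rewrite v0 mulr0 leNgt; apply/negP => p.
  have := z (Num.truncn (M / enorm (v *m A))).+1.
  by rewrite -ler_pdivlMr // leNgt truncnS_gt.
have v_gt0 : 0 < enorm v by rewrite lt_neqAle eq_sym v0 enorm_ge0.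
have e : v = enorm v *: ((enorm v)^-1 *: v) by rewrite scalerA divff // scale1r.
rewrite {1}e -scalemxAl enormZ (ger0_norm (enorm_ge0 v)) mulrC ler_wpM2r ?enorm_ge0 //.
apply: ub_le_sup.
  have [M hM] := enorm_mulmx_bounded A.
  by exists M => _ [w /= hw <-]; exact: hM.
exists ((enorm v)^-1 *: v) => //=.
by rewrite enormZ ger0_norm ?invr_ge0 ?enorm_ge0 // mulVf.
Qed.

Lemma quad_specnorm_le v A : `|dotv (v *m A) v| <= specnorm A * enorm v ^+ 2.
Proof.
apply: (le_trans (cauchy_schwarz _ _)).
by rewrite expr2 mulrA ler_wpM2r ?enorm_ge0 // specnorm_le.
Qed.

(** Upper bound on the Bregman divergence of the cube of the norm at [u]. After
    [dotv u v] is expressed by the three norms, the claim only uses that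
    [enorm (u + v)] differs from [enorm u] by at most [enorm v]. *)
Lemma enormD_cube u v : enorm (u + v) ^+ 3 <=
  enorm u ^+ 3 + 3 * enorm u * dotv u v + 3 * enorm u * enorm v ^+ 2 + enorm v ^+ 3.
Proof.
have e : dotv u v = (enorm (u + v) ^+ 2 - enorm u ^+ 2 - enorm v ^+ 2) / 2.
  by rewrite !enorm2 dotvDl !dotvDr (dotvC v u); field.
rewrite e.
have h1 := enormD u v.
have h2 : enorm u <= enorm (u + v) + enorm v.
  by rewrite -{1}(addrK v u) (le_trans (enormD _ _)) // enormN.
move: h1 h2 (enorm_ge0 u) (enorm_ge0 v) (enorm_ge0 (u + v)) {e}.
move: (enorm u) (enorm v) (enorm (u + v)) => r b m h1 h2 r0 b0 m0.
have p1 : 0 <= r * ((b - (m - r)) * (b + (m - r))).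
  by rewrite !mulr_ge0 //; lra.
have p2 : (m - r) ^+ 3 <= b ^+ 3.
  have : 0 <= (b - (m - r)) * (b ^+ 2 + b * (m - r) + (m - r) ^+ 2).
    rewrite mulr_ge0 //; first lra.
    have : 0 <= (b + (m-r)/2)^+2 by rewrite sqr_ge0.
    have : 0 <= (m-r)^+2 by rewrite sqr_ge0.
    nra.
  nra.
nra.
Qed.

End Euclid.

(** * Second-order Taylor bounds *)

Section Lines.
Local Open Scope classical_set_scope.
Local Open Scope ring_scope.

Lemma is_derive_line (R : realType) (V W : normedModType R) (F : V -> W)
    (x u : V) (s : R) :
  differentiable F (x + s *: u) ->
  is_derive s (1 : R) (fun s : R => F (x + s *: u)) ('D_u F (x + s *: u)).
Proof.
move=> dF; have := diff_derivable (v := u) dF.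
rewrite /derivable => dv.
suff e : (fun h : R => h^-1 *: (((fun s : R => F (x + s *: u)) \o shift s)
      (h *: (1 : R)) - F (x + s *: u)))
  = (fun h : R => h^-1 *: ((F \o shift (x + s *: u)) (h *: u) - F (x + s *: u))).
  split; first by rewrite /derivable e.
  by rewrite /derive e.
apply/funext => h /=; congr (_ *: (F _ - _)).
by rewrite scalerDl /GRing.scale /= mulr1 addrC -addrA (addrC (s *: u)).
Qed.

Lemma dotv_continuous (R : realType) n (w : 'rV[R]_n) :
  continuous (fun v : 'rV[R]_n => dotv v w).
Proof.
have -> : (fun v : 'rV[R]_n => dotv v w) = (fun v => \sum_j v 0 j * w 0 j).
  by apply/funext => v'; rewrite dotvE.
apply: continuous_big => [|j _]; first exact: add_continuous.
move=> v; apply: (@continuousM _ _ (fun u : 'rV[R]_n => u 0 j) (cst (w 0 j))).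
  exact: coord_continuous.
exact: cst_continuous.
Qed.

Lemma is_derive_dotv (R : realType) n (G : R -> 'rV[R]_n) (dG w : 'rV[R]_n)
    (s : R) :
  is_derive s (1 : R) G dG ->
  is_derive s (1 : R) (fun s => dotv (G s) w) (dotv dG w).
Proof.
move=> [dGs <-].
have h : (fun h : R => h^-1 *: (((fun s => dotv (G s) w) \o shift s) (h *: (1 : R))
    - dotv (G s) w)) @ 0^' --> dotv ('D_1 G s) w.
  have e : (fun h : R => h^-1 *: (((fun s => dotv (G s) w) \o shift s)
        (h *: (1 : R)) - dotv (G s) w))
    = (fun v => dotv v w) \o (fun h : R => h^-1 *: ((G \o shift s) (h *: (1 : R)) - G s)).
    by apply/funext => t /=; rewrite dotvZl dotvDl dotvNl.
  rewrite e; apply: continuous_cvg; first exact: dotv_continuous.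
  exact: dGs.
split; first by apply/cvg_ex; eexists; exact: h.
exact: cvg_lim h.
Qed.

End Lines.

Section Derivatives.
Context {R : realType} {n : nat} (f : 'rV[R]_n -> R).
Hypothesis f_C2 : twice_cont_diff f.

Lemma derive_grad x u : 'D_u f x = dotv (grad f x) u.
Proof.
have [df _ _] := f_C2.
rewrite deriveE // dotvE.
rewrite {1}(row_sum_delta u) linear_sum; apply: eq_bigr => j _.
by rewrite linearZ mxE deriveE //= mulrC.
Qed.

Lemma is_derive_f x u s :
  is_derive s (1 : R) (fun s : R => f (x + s *: u)) (dotv (grad f (x + s *: u)) u).
Proof. by have [df _ _] := f_C2; rewrite -derive_grad; apply: is_derive_line. Qed.

Lemma is_derive_grad x u s :
  is_derive s (1 : R) (fun s : R => dotv (grad f (x + s *: u)) u)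
    (dotv (u *m hess f (x + s *: u)) u).
Proof.
have [_ dg _] := f_C2.
rewrite /hess -deriveEjacobian //.
by apply: is_derive_dotv; apply: is_derive_line.
Qed.

End Derivatives.

Lemma ge0_of_derive_ge0 (R : realType) (F dF : R -> R) :
  (forall s, is_derive s (1 : R) F (dF s)) -> F 0 = 0 ->
  (forall s, 0 <= s -> 0 <= dF s) -> forall s, 0 <= s -> 0 <= F s.
Proof.
move=> hF F0 hd s s0; rewrite -F0.
apply: (@ger0_derive1_ndecr R F 0 s) => //.
- by move=> x /itvP hx; rewrite derive1E derive_val hd ?hx.
- apply: continuous_subspaceT => x; apply: differentiable_continuous.
  apply/derivable1_diffP; exact: (@ex_derive _ _ _ _ _ _ _ (hF x)).
Qed.

(** Second-order Taylor bound when the second derivative drops at most linearly: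
    the difference of the two sides, as a function of the endpoint, has a
    nonnegative second derivative and vanishes to first order at 0. *)
Lemma taylor2_lower (R : realType) (F F1 F2 : R -> R) (C : R) :
  (forall s, is_derive s (1 : R) F (F1 s)) ->
  (forall s, is_derive s (1 : R) F1 (F2 s)) ->
  (forall s, 0 <= s -> F2 0 - C * s <= F2 s) ->
  F 0 + F1 0 + F2 0 / 2 - C / 6 <= F 1.
Proof.
move=> h1 h2 hC.
pose G1 s := F1 s - F1 0 - F2 0 * s + C / 2 * s ^+ 2.
pose G s := F s - F 0 - F1 0 * s - F2 0 / 2 * s ^+ 2 + C / 6 * s ^+ 3.
have hG1 s : is_derive s (1 : R) G1 (F2 s - F2 0 + C * s).
  have -> : G1 = F1 - cst (F1 0) - F2 0 *: id + (C / 2) *: (id ^+ 2).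
    by apply/funext => r.
  have d1 : is_derive s (1 : R) id (1 : R) by exact: is_derive_id.
  have d := is_deriveD (is_deriveB (is_deriveB (h2 s) (is_derive_cst (F1 0) s 1))
    (is_deriveZ (F2 0) d1)) (is_deriveZ (C / 2) (is_deriveX 2 d1)).
  by apply: (is_derive_eq d); rewrite !scaler1 subr0 /GRing.scale /= expr1; lra.
have hG s : is_derive s (1 : R) G (G1 s).
  have -> : G = F - cst (F 0) - F1 0 *: id - (F2 0 / 2) *: (id ^+ 2) + (C / 6) *: (id ^+ 3).
    by apply/funext => r.
  have d1 : is_derive s (1 : R) id (1 : R) by exact: is_derive_id.
  have d := is_deriveD (is_deriveB (is_deriveB (is_deriveB (h1 s) (is_derive_cst (F 0) s 1))
    (is_deriveZ (F1 0) d1)) (is_deriveZ (F2 0 / 2) (is_deriveX 2 d1)))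
    (is_deriveZ (C / 6) (is_deriveX 3 d1)).
  by apply: (is_derive_eq d); rewrite /G1 !scaler1 subr0 /GRing.scale /= expr1; lra.
have G10 : G1 0 = 0 by rewrite /G1 mulr0 expr0n mulr0; ring.
have G0 : G 0 = 0 by rewrite /G !mulr0 !expr0n !mulr0; ring.
have dG1 s : 0 <= s -> 0 <= F2 s - F2 0 + C * s by move=> /hC; lra.
have p1 := @ge0_of_derive_ge0 R G1 _ hG1 G10 dG1.
have := @ge0_of_derive_ge0 R G G1 hG G0 p1 1 ler01.
rewrite /G !expr1n !mulr1; lra.
Qed.

Definition quad (R : realType) (n : nat) (A : 'M[R]_n) (v : 'rV[R]_n) : R :=
  dotv (v *m A) v.

Lemma quadZ (R : realType) n (A : 'M[R]_n) a v : quad A (a *: v) = a ^+ 2 * quad A v.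
Proof. by rewrite /quad -scalemxAl dotvZl dotvZr mulrA. Qed.

Lemma quadN (R : realType) n (A : 'M[R]_n) v : quad A (- v) = quad A v.
Proof. by rewrite /quad mulNmx dotvNl dotvNr opprK. Qed.

Lemma quadB (R : realType) n (A B : 'M[R]_n) v : quad (A - B) v = quad A v - quad B v.
Proof. by rewrite /quad mulmxBr dotvDl dotvNl. Qed.

(** How first-order optimality conditions are read off: if the increment of a
    function is bounded by a linear term plus higher-order terms, minimality
    makes the linear term vanish. The cubic term is present because both the
    model and the Taylor bound have one. *)
Lemma linear_term_eq0 (R : realFieldType) (L C : R) :
  (forall t, 0 <= t * L + C * (t ^+ 2 + `|t| ^+ 3)) -> L = 0.
Proof.
move=> h; apply/eqP/negP => /negP L0.
have nL : 0 < `|L| by rewrite normr_gt0.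
pose K := 2 * `|C| + `|L|.
have K0 : 0 < K by rewrite /K; have := normr_ge0 C; lra.
(* small enough for the linear term to dominate *)
have := h (- (L / K)).
have t1 : `|L / K| <= 1.
  rewrite normf_div (gtr0_norm K0) ler_pdivrMr // mul1r /K; have := normr_ge0 C; lra.
rewrite normrN sqrrN => ht.
have : C * ((L / K) ^+ 2 + `|L / K| ^+ 3) <= `|C| * (2 * (L/K)^+2).
  apply: (le_trans (ler_wpM2r _ (ler_norm C))); first by rewrite addr_ge0 ?sqr_ge0 ?exprn_ge0.
  rewrite ler_wpM2l // -[(L/K)^+2](real_normK (num_real _)); have := normr_ge0 (L/K); nra.
have e : - (L / K) * L = - (L / K) ^+ 2 * K by field; rewrite gt_eqF.
have : 0 < (L/K)^+2.
  by rewrite lt_neqAle sqr_ge0 andbT eq_sym sqrf_eq0 mulf_neq0 // invr_eq0 gt_eqF.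
move: ht; rewrite e /K; nra.
Qed.

Section Taylor.
Context {R : realType} {n : nat} (f : 'rV[R]_n -> R) (gamma : R).
Hypothesis f_C2 : twice_cont_diff f.
Hypothesis f_lip : lipschitz_hess gamma f.

Lemma quad_hess_lip x y u :
  `|quad (hess f x) u - quad (hess f y) u| <= gamma * enorm (x - y) * enorm u ^+ 2.
Proof.
rewrite -quadB; apply: (le_trans (quad_specnorm_le _ _)).
by rewrite ler_wpM2r ?sqr_ge0 ?f_lip.
Qed.

Lemma quad_hess_line x u s : 0 <= s ->
  `|quad (hess f (x + s *: u)) u - quad (hess f x) u| <= gamma * enorm u ^+ 3 * s.
Proof.
move=> s0; apply: (le_trans (quad_hess_lip _ _ _)).
by rewrite addrC addKr enormZ ger0_norm // le_eqVlt; apply/orP; left; apply/eqP; ring.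
Qed.

Lemma taylor_ge x u :
  f x + dotv (grad f x) u + quad (hess f x) u / 2 - gamma / 6 * enorm u ^+ 3 <= f (x + u).
Proof.
have hC s : 0 <= s ->
    quad (hess f (x + 0 *: u)) u - gamma * enorm u ^+ 3 * s <= quad (hess f (x + s *: u)) u.
  move=> s0; have := quad_hess_line x u s0.
  by rewrite ler_distl scale0r addr0 => /andP[].
have := taylor2_lower (is_derive_f f_C2 x u) (is_derive_grad f_C2 x u) hC.
rewrite scale0r addr0 scale1r -/(quad _ _).
by move: (quad _ _) (dotv _ _) (f x) (f (x + u)) (enorm u ^+ 3) => *; lra.
Qed.

Lemma taylor_le x u :
  f (x + u) <= f x + dotv (grad f x) u + quad (hess f x) u / 2 + gamma / 6 * enorm u ^+ 3.
Proof.
have hC s : 0 <= s ->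
    - quad (hess f (x + 0 *: u)) u - gamma * enorm u ^+ 3 * s <= - quad (hess f (x + s *: u)) u.
  move=> s0; have := quad_hess_line x u s0.
  by rewrite ler_distl scale0r addr0 -opprD lerN2 => /andP[].
have := taylor2_lower (fun s => is_deriveN (is_derive_f f_C2 x u s))
  (fun s => is_deriveN (is_derive_grad f_C2 x u s)) hC.
rewrite !fctE scale0r addr0 scale1r -/(quad _ _).
by move: (quad _ _) (dotv _ _) (f x) (f (x + u)) (enorm u ^+ 3) => *; lra.
Qed.

Lemma grad_min_eq0 z : is_minimizer f z -> forall h, dotv (grad f z) h = 0.
Proof.
move=> zmin h; apply: (@linear_term_eq0 R _
  (`|quad (hess f z) h| / 2 + `|gamma| / 6 * enorm h ^+ 3)) => t.
have := le_trans (zmin (z + t *: h)) (taylor_le z (t *: h)).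
rewrite dotvZr quadZ enormZ exprMn.
have e3 := exprn_ge0 3 (enorm_ge0 h).
have t2 := sqr_ge0 t. have t3 := exprn_ge0 3 (normr_ge0 t).
have : t ^+ 2 * quad (hess f z) h <= t ^+ 2 * `|quad (hess f z) h|.
  by rewrite ler_wpM2l // ler_norm.
have : gamma * (`|t| ^+ 3 * enorm h ^+ 3) <= `|gamma| * (`|t| ^+ 3 * enorm h ^+ 3).
  by apply: ler_wpM2r; [rewrite mulr_ge0|exact: ler_norm].
have : 0 <= `|t| ^+ 3 * `|quad (hess f z) h| by rewrite mulr_ge0.
have : 0 <= t ^+ 2 * (`|gamma| * enorm h ^+ 3) by rewrite mulr_ge0 // mulr_ge0.
move: t2 t3 e3.
move: (quad (hess f z) h) => q.
move: (dotv (grad f z) h) => l.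
move: (f z) => c.
move: (enorm h ^+ 3) => e.
move: (t ^+ 2) => a.
move: (`|t| ^+ 3) => b.
move=> *; nra.
Qed.

End Taylor.

(** * One step of the method *)

Lemma const_term_ge0 (R : realFieldType) (q C : R) :
  (forall s, 0 < s -> 0 <= q + C * s) -> 0 <= q.
Proof.
move=> h; rewrite leNgt; apply/negP => q0.
have K0 : 0 < 2 * (`|C| + 1) by have := normr_ge0 C; lra.
have := h (- q / (2 * (`|C| + 1))); rewrite divr_gt0 // ?oppr_gt0 // => /(_ isT).
have : C * (- q / (2 * (`|C| + 1))) <= - q / 2.
  rewrite mulrA ler_pdivrMr //; have := ler_norm C; nra.
lra.
Qed.

Section Model.
Context {R : realType} {n : nat} (f : 'rV[R]_n -> R) (gamma : R) (H : 'M[R]_n).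
Implicit Types (x u v d h : 'rV[R]_n).

Lemma cubic_modelE x u : cubic_model f gamma H x (x + u) =
  f x + dotv (grad f x) u + quad H u / 2 + gamma / 6 * enorm u ^+ 3.
Proof. by rewrite /cubic_model (addrC x u) addrK (mulrC 2^-1). Qed.

Hypothesis gamma_ge0 : 0 <= gamma.
Hypothesis H_sym : H^T = H.

Lemma quadD u v : quad H (u + v) = quad H u + 2 * dotv (u *m H) v + quad H v.
Proof.
have e : dotv (v *m H) u = dotv (u *m H) v.
  by rewrite dotvC /dotv trmx_mul H_sym mulmxA.
by rewrite /quad mulmxDl dotvDl !dotvDr e; ring.
Qed.

(** At its minimizer the model has no first-order term, so that its increments
    are exactly the quadratic form of [H] plus the Bregman divergence of the
    cubic regularizer. *)
Lemma cubic_model_min_expand x d : is_minimizer (cubic_model f gamma H x) (x + d) ->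
  forall h, cubic_model f gamma H x (x + (d + h)) = cubic_model f gamma H x (x + d)
    + quad H h / 2
    + gamma / 6 * (enorm (d + h) ^+ 3 - enorm d ^+ 3 - 3 * enorm d * dotv d h).
Proof.
move=> dmin h.
have foc : dotv (grad f x) h + dotv (d *m H) h + gamma / 2 * enorm d * dotv d h = 0.
  apply: (@linear_term_eq0 R _ (`|quad H h| / 2
    + gamma / 6 * (3 * enorm d * enorm h ^+ 2 + enorm h ^+ 3))) => t.
  have := dmin (x + (d + t *: h)).
  have := ler_wpM2l gamma_ge0 (enormD_cube d (t *: h)).
  rewrite !cubic_modelE quadD quadZ !dotvDr !dotvZr enormZ !exprMn real_normK ?num_real //.
  have : t ^+ 2 * quad H h <= t ^+ 2 * `|quad H h| by rewrite ler_wpM2l ?sqr_ge0 // ler_norm.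
  have : 0 <= `|t| ^+ 3 * `|quad H h| by rewrite mulr_ge0 // exprn_ge0.
  have : 0 <= gamma * (t ^+ 2 * enorm h ^+ 3).
    by rewrite mulr_ge0 // mulr_ge0 ?sqr_ge0 ?exprn_ge0 ?enorm_ge0.
  have : 0 <= gamma * (`|t| ^+ 3 * (enorm d * enorm h ^+ 2)).
    by rewrite mulr_ge0 // mulr_ge0 ?exprn_ge0 // mulr_ge0 ?exprn_ge0 ?enorm_ge0.
  move: (quad H h) (quad H d) (dotv (grad f x) d) (dotv (grad f x) h).
move: (dotv (d *m H) h) (dotv d h).
  move: (enorm (d + t *: h)) (enorm d) (enorm h) (f x) => *; lra.
rewrite !cubic_modelE quadD !dotvDr.
move: foc.
move: (quad H h) (quad H d) (dotv (grad f x) d) (dotv (grad f x) h).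
move: (dotv (d *m H) h) (dotv d h).
move: (enorm (d + h)) (enorm d) (enorm h) (f x) => *; lra.
Qed.

End Model.

Section Step.
Context {R : realType} {n : nat} (f : 'rV[R]_n -> R) (gamma lambda mu : R).
Hypothesis f_C2 : twice_cont_diff f.
Hypothesis f_lip : lipschitz_hess gamma f.
Hypothesis gamma_ge0 : 0 <= gamma.
Hypothesis lambda_ge0 : 0 <= lambda.
Hypothesis f_sc : strongly_convex lambda f.

Lemma quad_hess_ge0 p u : 0 <= quad (hess f p) u.
Proof.
apply: (@const_term_ge0 R _ (gamma / 3 * enorm u ^+ 3)) => s s0.
have := f_sc (p + s *: u) (p - s *: u) (alpha := 2^-1).
have -> : 2^-1 *: (p + s *: u) + (1 - 2^-1) *: (p - s *: u) = p.
  have -> : 1 - 2^-1 = 2^-1 :> R by field.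
  rewrite -scalerDr addrACA subrr addr0 -mulr2n -[p *+ 2]scaler_nat scalerA.
  by rewrite mulVf ?scale1r // pnatr_eq0.
have -> : 0 <= (2^-1 : R) <= 1 by lra.
move=> /(_ isT).
have := taylor_le f_C2 f_lip p (s *: u).
have := taylor_le f_C2 f_lip p (- (s *: u)).
rewrite quadN dotvNr dotvZr quadZ enormN enormZ (gtr0_norm s0) exprMn.
have : 0 <= lambda * enorm (p + s *: u - (p - s *: u)) ^+ 2.
  by rewrite mulr_ge0 ?sqr_ge0.
move: (enorm (p + s *: u - (p - s *: u)) ^+ 2) (quad _ _) (dotv _ _).
move: (f _) (f _) (f _) (enorm u ^+ 3).
move=> f1 f2 f0 e m q l *.
have : 0 <= s ^+ 2 * (q + gamma / 3 * e * s) by lra.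
by rewrite pmulr_rge0 // exprn_gt0.
Qed.

Variables (H : 'M[R]_n) (x d z : 'rV[R]_n).
Hypothesis H_sym : H^T = H.
Hypothesis H_ge : forall v, quad (hess f x) v <= quad H v.
Hypothesis H_le : forall v, quad H v <= quad (hess f x) v + mu * enorm v ^+ 2.
Hypothesis d_min : is_minimizer (cubic_model f gamma H x) (x + d).

Let D := enorm (z - x).
Let W := enorm (z - (x + d)).
Let r := enorm d.

Lemma f_le_cubic_model u : f (x + u) <= cubic_model f gamma H x (x + u).
Proof.
apply: (le_trans (taylor_le f_C2 f_lip x u)); rewrite cubic_modelE.
by rewrite lerD2r lerD2l ler_pM2r // invr_gt0.
Qed.

Lemma cubic_model_le_f u : cubic_model f gamma H x (x + u) <=
  f (x + u) + mu / 2 * enorm u ^+ 2 + gamma / 3 * enorm u ^+ 3.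
Proof.
have := taylor_ge f_C2 f_lip x u; have := H_le u; rewrite cubic_modelE.
move: (quad _ _) (quad _ _) (dotv _ _) (f _) (f _) (enorm _) => *; lra.
Qed.

(** Comparison of the model minimum with the point at the fraction [a] of the
    segment from [x] to [z]. The growth of the model away from its minimizer is
    kept: a plain comparison would only have [a ^+ 3 * D ^+ 3 / 3] in the last
    factor, and the present bound reduces to it when [d = a *: (z - x)]. *)
Lemma model_step_le (a : R) : 0 <= a <= 1 ->
  cubic_model f gamma H x (x + d) <= (1 - a) * f x + a * f z
   - a * (1 - a) * lambda / 2 * D ^+ 2 + mu / 2 * a ^+ 2 * D ^+ 2
   + gamma * (a ^+ 3 * D ^+ 3 / 6 - r ^+ 3 / 3 + r * a * dotv d (z - x) / 2).
Proof.
move=> /andP[a0 a1].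
have := cubic_model_min_expand gamma_ge0 H_sym d_min (a *: (z - x) - d).
have -> : d + (a *: (z - x) - d) = a *: (z - x) by rewrite addrC subrK.
have := cubic_model_le_f (a *: (z - x)).
have := f_sc z x (alpha := a); rewrite a0 a1 => /(_ isT).
have -> : x + a *: (z - x) = a *: z + (1 - a) *: x.
  by apply/rowP => j; rewrite !mxE; ring.
rewrite (dotvDr d (a *: _)) (dotvNr d d) dotvZr -enorm2 -/r enormZ (ger0_norm a0) !exprMn -/D.
have : 0 <= quad H (a *: (z - x) - d).
  by apply: le_trans (H_ge _); apply: quad_hess_ge0.
move: (quad _ _) (cubic_model _ _ _ _ _) (cubic_model _ _ _ _ _) (dotv _ _).
move=> q m1 m2 zeta; move: (f _) (f x) (f z) => fa fx fz *; lra.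
Qed.

(** The point [y] lies between [z] and [y - b *: (z - y)], so convexity bounds
    [f] from below at the latter. *)
Lemma strongly_convex_extrapolate y (b : R) : 0 <= b ->
  f y + b * (f y - f z) + b * (1 + b) * lambda / 2 * enorm (z - y) ^+ 2 <=
  f (y - b *: (z - y)).
Proof.
move=> b0.
have b10 : 1 + b != 0 by rewrite gt_eqF //; lra.
have hb : 0 <= b / (1 + b) <= 1.
  by rewrite divr_ge0 ?ler_pdivrMr /= ?mul1r; lra.
have := f_sc z (y - b *: (z - y)) hb.
have -> : b / (1 + b) *: z + (1 - b / (1 + b)) *: (y - b *: (z - y)) = y.
  by apply/rowP => j; rewrite !mxE; field.
have -> : z - (y - b *: (z - y)) = (1 + b) *: (z - y).
  by apply/rowP => j; rewrite !mxE; ring.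
rewrite enormZ ger0_norm; last lra.
have b1 : 0 <= 1 + b by lra.
move=> /(ler_wpM2l b1).
have -> : (1 + b) * (b / (1 + b) * f z + (1 - b / (1 + b)) * f (y - b *: (z - y))
    - b / (1 + b) * (1 - b / (1 + b)) * lambda / 2 * ((1 + b) * enorm (z - y)) ^+ 2)
  = b * f z + f (y - b *: (z - y)) - b * (1 + b) * lambda / 2 * enorm (z - y) ^+ 2.
  by move: (f _) (f z) (enorm _) => *; field.
by move: (f (y - _)) (f y) (f z) (enorm _) => *; lra.
Qed.

(** The model exceeds [f] at its own minimizer [y = x + d] as soon as [f y] is
    not optimal. The witness is the point [y - b *: (z - y)], on the side of [y]
    opposite to [z], where the model is an upper bound for [f]. There [f] is
    bounded below in two ways: by convexity, and by a second difference at [y]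
    that sees the curvature of [f] in the direction [z - y]. In the average of
    the two bounds this curvature cancels the quadratic part of the model up to
    [mu] and to the Lipschitz constant of the Hessian. *)
Lemma model_step_ge (b : R) : 0 <= b <= 1 ->
  f (x + d) + b * (f (x + d) - f z) + b * lambda / 2 * W ^+ 2
   - mu / 2 * b ^+ 2 * W ^+ 2 - gamma * (r * b ^+ 2 * W ^+ 2 + b ^+ 3 * W ^+ 3 / 3)
  <= cubic_model f gamma H x (x + d).
Proof.
move=> /andP[b0 b1].
rewrite /W; set y := x + d; set w := z - y.
have ey2 : b *: z + (1 - b) *: y = y + b *: w.
  by apply/rowP => j; rewrite !mxE; ring.
have ed : x + (d - b *: w) = y - b *: w by rewrite addrA.
have exy : y - x = d by rewrite /y addrC addKr.
have q1 := cubic_model_min_expand gamma_ge0 H_sym d_min (- (b *: w)).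
have q2 := f_le_cubic_model (d - b *: w).
have q3 := ler_wpM2l gamma_ge0 (enormD_cube d (- (b *: w))).
(* first lower bound on f (y - b *: w) *)
have q4 := strongly_convex_extrapolate y b0.
(* second one: the second difference of f at y, whose value at y + b *: w is
   bounded by convexity *)
have q5 := f_sc z y (introT andP (conj b0 b1)).
have q6 := taylor_ge f_C2 f_lip y (b *: w).
have q7 := taylor_ge f_C2 f_lip y (- (b *: w)).
have q8 := quad_hess_lip f_lip y x (b *: w).
have q9 := H_le (b *: w).
rewrite ed in q1 q2; rewrite -/w in q4; rewrite ey2 -/w in q5.
rewrite exy ler_distl in q8; case/andP: q8 => q8 _.
rewrite -/y (quadN H) in q1; rewrite enormN in q3.
rewrite quadN dotvNr enormN in q7.
rewrite /r; move: q1 q2 q3 q4 q5 q6 q7 q8 q9; clearbody w y.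
have eW : enorm (b *: w) = b * enorm w by rewrite enormZ ger0_norm.
move: (hess f y) (hess f x) (grad f y) => My Mx g.
rewrite eW !(quadZ _ b w) !(dotvNr d) !(dotvZr b).
move: (cubic_model _ _ _ _ _) (cubic_model _ _ _ _ _) => m1 m2.
move: (quad _ _) (quad _ _) (quad _ _) (dotv _ _) (dotv _ _) => k1 k2 k3 l1 l2.
move: (enorm (d + _)) (enorm d) (enorm w) => nh nd nw.
move: (f (y - b *: w)) (f (y + b *: w)) (f y) (f z) => f1 f2 f3 f4.
by move=> *; lra.
Qed.

End Step.

(** * Scalar inequalities *)

(** At [rho = 4/5] the left-hand side is close to its minimum in [rho] for all
    admissible [A]; the cubic in [rho] is therefore expanded there, and its
    constant term dominates the small linear one. *)
Lemma contraction_poly_ge0 (R : realFieldType) (A rho a q : R) :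
  0 <= A <= 3^-1 -> 0 <= rho ->
  a = (3 + 2 * A) / 5 -> q = (1 - A * rho) ^+ 2 ->
  0 <= (1 + 6/5*A) * (a * (1 - a * A) / 2 - a^+2/12 + 18/125 * q)
   - 2 * (a^+3/6 - rho^+3/3 + a*rho^+2/2 + 4/25*rho*q).
Proof.
move=> /andP[A0 A3] r0 ea eq.
pose c3 := 2/3 - 8/25*A^+2.
pose c2 := - a + 16/25 * A + (1 + 6/5*A)*(18/125)*A^+2.
pose c1 := - (8/25) - (36/125)* A * (1 + 6/5*A).
pose c0 := (1 + 6/5*A) * (a * (1 - a * A) / 2 - a^+2/12 + 18/125) - a^+3/3.
have -> : (1 + 6/5*A) * (a * (1 - a * A) / 2 - a^+2/12 + 18/125 * q)
   - 2 * (a^+3/6 - rho^+3/3 + a*rho^+2/2 + 4/25*rho*q)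
   = (rho - 4/5)^+2 * (c3 * (rho + 8/5) + c2)
     + (48/25*c3 + 8/5*c2 + c1) * (rho - 4/5) + (64/125*c3+16/25*c2+4/5*c1 + c0).
  rewrite /c3 /c2 /c1 /c0 eq; by field.
have A2 : 0 <= A^+2 by rewrite sqr_ge0.
have A2' : A^+2 <= 3^-1 * A by rewrite expr2 ler_wpM2r.
have hA3 : 0 <= A^+3 by rewrite exprn_ge0.
have A3' : A^+3 <= 3^-1 * A^+2 by rewrite exprS ler_wpM2r.
have hA4 : 0 <= A^+4 by rewrite exprn_ge0.
have A4' : A^+4 <= 3^-1 * A^+3 by rewrite exprS ler_wpM2r.
have hc3 : 3/5 <= c3 by rewrite /c3; lra.
have hc2 : - (3/5) <= c2 by rewrite /c2 ea; lra.
have hK : 9/25 <= c3 * (rho + 8/5) + c2 by nra.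
have hF : 3/100 <= 64/125*c3+16/25*c2+4/5*c1 + c0.
  rewrite /c3 /c2 /c1 /c0 ea; lra.
have hs : (48/25*c3 + 8/5*c2 + c1)^+2 <= 1/25.
  have : -(1/5) <= (48/25*c3 + 8/5*c2 + c1) <= 1/5 by rewrite /c3 /c2 /c1 ea; lra.
  nra.
move: hK hF hs.
move: (c3 * _ + _) (64/125*c3+16/25*c2+4/5*c1 + c0) (48/25*c3 + 8/5*c2 + c1).
move=> K F0 s hK hF hs; move: (rho - 4/5) => u.
have : 9/25 * u^+2 <= u^+2 * K by rewrite mulrC ler_wpM2l // sqr_ge0.
have : 0 <= (5/6*s + 3/5*u)^+2 by rewrite sqr_ge0.
lra.
Qed.

(** The case [D = W = 1] of the next inequality, with the largest [X]. It is
    affine in [n], so it suffices to check it at the two ends of the range of [n]. *)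
Lemma potential_poly_diam_ge0 (R : realFieldType) (n rho : R) :
  0 <= n <= 4^-1 -> 0 <= rho ->
  0 <= 36/25 - 3/5 * n * rho^+2 + 6/5 * rho
    - (1-n) * (rho^+2 + 4/3 - rho^+3/3 + 9/25 * rho + 9/125).
Proof.
move=> /andP[n0 n4] rho0.
have h1 : 0 <= 36/25 + 6/5*rho - (rho^+2 + 4/3 - rho^+3/3 + 9/25 * rho + 9/125).
  have : 0 <= (rho - 3/2)^+2 * (rho+ 3) by rewrite mulr_ge0 ?sqr_ge0 //; lra.
  have : 0 <= (rho - 3/2)^+2 by rewrite sqr_ge0.
  nra.
have h2 : 0 <= 36/25 - 3/5 * 4^-1 * rho^+2 + 6/5 * rho
    - (3/4) * (rho^+2 + 4/3 - rho^+3/3 + 9/25 * rho + 9/125).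
  have : 0 <= (rho - 2)^+2 * (rho+ 4) by rewrite mulr_ge0 ?sqr_ge0 //; lra.
  have : 0 <= (rho - 2)^+2 by rewrite sqr_ge0.
  nra.
have e : 36/25 - 3/5 * n * rho^+2 + 6/5 * rho
    - (1-n) * (rho^+2 + 4/3 - rho^+3/3 + 9/25 * rho + 9/125) =
  (1 - 4*n) * (36/25 + 6/5*rho - (rho^+2 + 4/3 - rho^+3/3 + 9/25 * rho + 9/125))
  + 4*n*(36/25 - 3/5 * 4^-1 * rho^+2 + 6/5 * rho
    - (3/4) * (rho^+2 + 4/3 - rho^+3/3 + 9/25 * rho + 9/125)).
  by field.
rewrite e addr_ge0 // mulr_ge0 //; lra.
Qed.

(** The coefficient of [X] is nonpositive by the lower bound on [rho], which
    makes the largest [X] the worst case; the same lower bound then makes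
    [D = 1] the worst case. *)
Lemma potential_poly_ge0 (R : realFieldType) (n rho D W X : R) :
  0 <= n <= 4^-1 -> 6/5 <= (1-n)*rho ->
  0 <= D <= 1 -> 0 <= W <= 1 -> X <= 2*D*rho - n * rho^+2 ->
  0 <= 3/5*(3 - 3/5*W^+2) + X * (3/5 - 2^-1*(1-n)*rho)
    - (1-n)*(4/3*D^+3 - rho^+3/3 + 2^-1*n*rho^+3 + 9/25*rho*W^+2 + 9/125*W^+3).
Proof.
move=> hn hr /andP[D0 D1] /andP[W0 W1] hX.
have /andP[n0 n4] := hn.
have rho0 : 0 <= rho by nra.
have := potential_poly_diam_ge0 hn rho0.
have W2 : W^+2 <= 1 by rewrite expr_le1.
have W3 : W^+3 <= 1 by rewrite expr_le1.
have W20 : 0 <= W^+2 by rewrite sqr_ge0.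
have hk : 0 <= 2^-1*(1-n)*rho - 3/5 by lra.
have hX' : 0 <= (2*D*rho - n * rho^+2 - X) * (2^-1*(1-n)*rho - 3/5).
  by rewrite mulr_ge0 // subr_ge0.
have hD : 0 <= (1-D) * (((1-n)*rho - 6/5)*rho).
  rewrite mulr_ge0 ?mulr_ge0 ?subr_ge0 //; lra.
have D3 : D^+3 <= 1 by rewrite expr_le1.
have q1 : 0 <= (1-n) * (1 - D^+3) by rewrite mulr_ge0 //; lra.
have q2 : 0 <= (1-n) * rho * (1 - W^+2) by rewrite !mulr_ge0 //; lra.
have q3 : 0 <= (1-n) * (1 - W^+3) by rewrite mulr_ge0 //; lra.
lra.
Qed.

(** One step of the linear rate. The weights are proportional to [A] and satisfy
    [(1 + b) * (1 - A) = 1 - a], so that the gap [dl] disappears from the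
    inequality that remains to be checked. That inequality is affine in [gamma]
    and holds for [gamma = 0], hence is only needed for the largest [gamma].
    After [W ^+ 3 <= rad * W ^+ 2] it is also affine in [W ^+ 2], with the least
    value as worst case, which is the case of a step pointing straight at the
    minimizer. *)
Lemma contraction_step (R : realFieldType)
    (A lambda mu gamma rad D W r zeta dl dl' M : R) :
  0 < A <= 3^-1 -> 0 <= lambda -> 6 * mu * A <= lambda -> 0 <= gamma ->
  gamma * rad * A ^+ 2 <= 2 * lambda -> 0 < D -> D * (1 + 6/5 * A) <= rad ->
  0 <= W <= rad -> 0 <= r -> (D - r) ^+ 2 <= W ^+ 2 ->
  zeta = (D ^+ 2 + r ^+ 2 - W ^+ 2) / 2 ->
  (forall a, 0 <= a <= 1 -> M <= (1 - a) * dl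
     - a * (1 - a) * lambda / 2 * D ^+ 2 + mu / 2 * a ^+ 2 * D ^+ 2
     + gamma * (a ^+ 3 * D ^+ 3 / 6 - r ^+ 3 / 3 + r * a * zeta / 2)) ->
  (forall b, 0 <= b <= 1 -> dl' + b * dl' + b * lambda / 2 * W ^+ 2
     - mu / 2 * b ^+ 2 * W ^+ 2
     - gamma * (r * b ^+ 2 * W ^+ 2 + b ^+ 3 * W ^+ 3 / 3) <= M) ->
  dl' <= (1 - A) * dl.
Proof.
move=> /andP[A0 A3] l0 hmu g0 hg D0 hD /andP[W0 WR] r0 hW -> S1 S2.
(* the weights are a = A * a' and b = 2/5 * A *)
pose a' := (3 + 2 * A) / 5.
have ha : 0 <= A * a' <= 1 by rewrite /a'; nra.
have hb : 0 <= 2/5 * A <= 1 by lra.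
have {}S1 := S1 _ ha; have {}S2 := S2 _ hb.
have rad0 : 0 < rad by nra.
pose rho := r / (A * D).
have AD : A * D != 0 by rewrite mulf_neq0 ?gt_eqF.
have er : r = A * D * rho by rewrite /rho mulrC divfK.
have rho0 : 0 <= rho by rewrite divr_ge0 // mulr_ge0 ?ltW.
pose q := (1 - A * rho) ^+ 2.
have A01 : 0 <= A <= 3^-1 by rewrite ltW.
have F := contraction_poly_ge0 A01 rho0 (erefl a') (erefl q).
pose N := a' * (1 - a' * A) / 2 - a' ^+ 2 / 12.
pose Y := W ^+ 2 - (D - r) ^+ 2.
have Y0 : 0 <= Y by rewrite /Y subr_ge0.
have N0 : 0 <= N.
  have A2 : 0 <= (3^-1 - A) * A by rewrite mulr_ge0 ?subr_ge0 // ltW.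
  have A3' : 0 <= (3^-1 - A) * A * A by rewrite mulr_ge0 // ltW.
  have A2' : 0 <= A * A * A by rewrite !mulr_ge0 // ltW.
  by rewrite /N /a'; nra.
pose K := (A*a') ^+ 3 * D ^+ 3 / 6 - r ^+ 3 / 3
    + r * (A*a') * ((D ^+ 2 + r ^+ 2 - W ^+ 2) / 2) / 2
  + (r * (2/5*A) ^+ 2 * W ^+ 2 + (2/5*A) ^+ 3 * W ^+ 3 / 3).
have hK : 2 * K <= rad * A ^+ 3 * (N * D ^+ 2 + 14/75 * W ^+ 2).
  have W3 : W ^+ 3 <= rad * W ^+ 2 by rewrite [W ^+ 3]exprS ler_wpM2r ?sqr_ge0.
  have A3W : 0 <= A ^+ 3 * (rad * W ^+ 2 - W ^+ 3).
    by rewrite mulr_ge0 ?subr_ge0 // exprn_ge0 // ltW.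
  have hY : 0 <= r * Y * (a' * A / 2 - 2 * (2/5*A)^+2).
    apply: mulr_ge0; first exact: mulr_ge0. rewrite /a'; nra.
  have hY2 : 0 <= rad * A ^+ 3 * Y by rewrite !mulr_ge0 ?exprn_ge0 // ltW.
  have hF : 0 <= A ^+ 3 * D ^+ 3 * ((1 + 6/5*A) * (N + 18/125 * q)
     - 2 * (a'^+3/6 - rho^+3/3 + a'*rho^+2/2 + 4/25*rho*q)).
    by rewrite mulr_ge0 // mulr_ge0 ?exprn_ge0 // ltW.
  have hR : 0 <= A ^+ 3 * ((rad - D * (1 + 6/5 * A)) * (D^+2 * (N + 18/125 * q))).
    apply: mulr_ge0; first by rewrite exprn_ge0 // ltW.
    apply: mulr_ge0; first by rewrite subr_ge0.
    by rewrite mulr_ge0 ?sqr_ge0 // addr_ge0 // mulr_ge0 ?sqr_ge0 //; lra.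
  have eW : W ^+ 2 = Y + D ^+ 2 * q by rewrite /Y /q er; ring.
  move: hR hF hY hY2 A3W.
  have -> : K = (A*a') ^+ 3 * D ^+ 3 / 6 - r ^+ 3 / 3
    + r * (A*a') * ((D ^+ 2 + r ^+ 2 - (Y + D ^+ 2 * q)) / 2) / 2
  + (r * (2/5*A) ^+ 2 * (Y + D ^+ 2 * q) + (2/5*A) ^+ 3 * W ^+ 3 / 3) by rewrite /K eW.
  rewrite eW /q er.
  clear; clearbody Y N a'.
  move: (W ^+ 3) => W3'. lra.
have step : (1 + 2/5 * A) * dl' <= (1 + 2/5*A) * ((1 - A) * dl).
  have eA : 1 - A * a' = (1 + 2/5*A) * (1 - A) by rewrite /a'; field.
  have Q : gamma * K <= lambda * A * (N * D ^+ 2 + 14/75 * W ^+ 2).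
    have [K0|K0] := leP K 0.
      apply: (@le_trans _ _ 0); first by rewrite mulr_ge0_le0.
      rewrite !mulr_ge0 ?(ltW A0) // addr_ge0 // mulr_ge0 ?sqr_ge0 //; lra.
    have p : 0 < rad * A ^+ 2 by rewrite mulr_gt0 // exprn_gt0.
    rewrite -(ler_pM2l p).
    apply: (@le_trans _ _ (2 * lambda * K)).
      by rewrite mulrA ler_wpM2r ?(ltW K0) // mulrC mulrA.
    apply: (@le_trans _ _ (lambda * (rad * A ^+ 3 * (N * D ^+ 2 + 14/75 * W ^+ 2)))).
      by have := ler_wpM2l l0 hK; clearbody K N; lra.
    by rewrite le_eqVlt; apply/orP; left; apply/eqP; ring.
  have m1 : 0 <= (lambda - 6 * mu * A) * (A * (a' ^+ 2 * D ^+ 2 + 4/25 * W ^+ 2)).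
    apply: mulr_ge0; first by rewrite subr_ge0.
    by rewrite mulr_ge0 ?(ltW A0) // addr_ge0 // mulr_ge0 ?sqr_ge0 //; lra.
  have {}eA : (1 - A * a') * dl = (1 + 2/5*A) * ((1 - A) * dl) by rewrite eA mulrA.
  move: Q m1 S1 S2 eA; rewrite /K /N; clear; clearbody a'; lra.
by rewrite -(@ler_pM2l _ (1 + 2/5 * A)) //; lra.
Qed.

(** One step of the sublinear rate from time [t] to [t + 1], where
    [n = 1 / (t + 3)] and lengths are measured in units of [rad]. The term [- 3/5 * D ^+ 2] of the potential pays for
    the steps that point at the minimizer: these decrease the gap little but
    decrease [D]. A short step is impossible unless the gap is already small,
    by comparing the lower bound on the model gap [M] with its upper bound in
    terms of [r]; a long step uses the weights [2 * n] and [3/5 * n]. The cutoff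
    between short and long is where the coefficient of [D ^+ 2 - W ^+ 2] changes
    sign. *)
Lemma potential_step (R : realFieldType)
    (n mu gamma D W r zeta dl dl' M : R) :
  0 < n <= 4^-1 -> 0 <= mu -> 0 <= gamma -> 0 <= D <= 1 -> 0 <= W <= 1 -> 0 <= r ->
  (D - r) ^+ 2 <= W ^+ 2 -> zeta = (D ^+ 2 + r ^+ 2 - W ^+ 2) / 2 ->
  (forall a, 0 <= a <= 1 -> M <= (1 - a) * dl + mu / 2 * a ^+ 2 * D ^+ 2
     + gamma * (a ^+ 3 * D ^+ 3 / 6 - r ^+ 3 / 3 + r * a * zeta / 2)) ->
  (forall b, 0 <= b <= 1 -> dl' + b * dl'
     - mu / 2 * b ^+ 2 * W ^+ 2
     - gamma * (r * b ^+ 2 * W ^+ 2 + b ^+ 3 * W ^+ 3 / 3) <= M) ->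
  M <= dl' + mu / 2 * r ^+ 2 + gamma / 3 * r ^+ 3 ->
  dl <= 9/2 * mu * (n / (1 - n))
     + gamma * (3 - 3/5 * D ^+ 2) * (n ^+ 2 / ((1 - 2 * n) * (1 - n))) ->
  dl' <= 9/2 * mu * n + gamma * (3 - 3/5 * W ^+ 2) * (n ^+ 2 / (1 - n)).
Proof.
move=> /andP[n0 n4] mu0 g0 /andP[D0 D1] /andP[W0 W1] r0 hW -> S1 S2 S3 hdl.
have n1 : 0 < 1 - n by lra.
have n2 : 0 < 1 - 2 * n by lra.
have W2 : W ^+ 2 <= 1 by rewrite expr_le1.
have W20 := sqr_ge0 W.
have W3 : W ^+ 3 <= 1 by rewrite expr_le1.
have W30 : 0 <= W ^+ 3 by rewrite exprn_ge0.
set x := n / (1 - n) in hdl *.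
have ex : x * (1 - n) = n by rewrite divfK // gt_eqF.
have x0 : 0 <= x by rewrite divr_ge0 // ltW.
have hx : 3 * x <= 4 * n.
  by have := mulr_ge0 x0 (_ : 0 <= 4^-1 - n); rewrite subr_ge0 n4 => /(_ isT); lra.
have x3 : x <= 3^-1 by rewrite ler_pdivrMr //; lra.
have -> : n ^+ 2 / (1 - n) = n * x by rewrite /x expr2 mulrA.
have [hr|hr] := ltP r (6/5 * x).
  (* the weight b = r / 2 would be natural; its largest value also covers r = 0 *)
  pose b := 3/5 * x.
  have b0 : 0 <= b by rewrite /b; lra.
  have b01 : 0 <= b <= 1 by rewrite b0 /b; lra.
  have {}S2 := le_trans (S2 _ b01) S3.
  have rb : r <= 2 * b by rewrite /b; lra.
  have r2 : r ^+ 2 <= 4 * b ^+ 2 by nra.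
  have r3 : r ^+ 3 <= 8 * b ^+ 3.
    have -> : 8 * b ^+ 3 = (2 * b) ^+ 3 by ring.
    by rewrite lerXn2r // nnegrE; lra.
  have b2W : b ^+ 2 * W ^+ 2 <= b ^+ 2 by rewrite ler_piMr ?sqr_ge0.
  have b3W : b ^+ 3 * W ^+ 3 <= b ^+ 3 by rewrite ler_piMr ?exprn_ge0.
  have rbW : r * b ^+ 2 * W ^+ 2 <= 2 * b ^+ 3.
    have -> : 2 * b ^+ 3 = (2 * b) * b ^+ 2 by ring.
    by rewrite -mulrA ler_pM // mulr_ge0 ?sqr_ge0.
  have h : b * dl' <= b * (5/2 * mu * b + 5 * gamma * b ^+ 2).
    have m1 : 0 <= mu * (5 * b ^+ 2 - (b ^+ 2 * W ^+ 2 + r ^+ 2)) by rewrite mulr_ge0 // ; lra.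
    have m2 : 0 <= gamma * (5 * b ^+ 3 - (r * b ^+ 2 * W ^+ 2 + b ^+ 3 * W ^+ 3 / 3 + r ^+ 3 / 3)).
      by rewrite mulr_ge0 //; lra.
    move: m1 m2 S2; clear; clearbody b; lra.
  have xp : 0 < x by rewrite divr_gt0.
  have bp : 0 < b by rewrite /b; lra.
  move: h; rewrite ler_pM2l // => h; apply: (le_trans h).
  have m1 : 0 <= mu * (3 * n - x) by rewrite mulr_ge0 //; lra.
  have m2 : 0 <= gamma * x * (12/5 * n - 9/5 * x).
    by apply: mulr_ge0; [apply: mulr_ge0|lra].
  have m3 : 0 <= gamma * (1 - W ^+ 2) * (n * x).
    by apply: mulr_ge0; [apply: mulr_ge0; rewrite ?subr_ge0|apply: mulr_ge0; rewrite ?ltW].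
  rewrite /b; move: m1 m2 m3; clear; clearbody x; lra.
pose rho := r / n.
have er : r = n * rho by rewrite /rho mulrC divfK // gt_eqF.
pose X := (D ^+ 2 - W ^+ 2) / n.
have eX : D ^+ 2 - W ^+ 2 = n * X by rewrite /X mulrC divfK // gt_eqF.
have hX : X <= 2 * D * rho - n * rho ^+ 2.
  rewrite ler_pdivrMr //.
  have -> : (2 * D * rho - n * rho ^+ 2) * n = 2 * D * r - r ^+ 2 by rewrite er; ring.
  by lra.
have hrho : 6/5 <= (1 - n) * rho.
  have : 6/5 * x * (1 - n) <= r * (1 - n) by rewrite ler_wpM2r // ltW.
  by rewrite -mulrA ex er -(ler_pM2l n0); lra.
have hn : 0 <= n <= 4^-1 by rewrite ltW.
have F := potential_poly_ge0 hn hrho (introT andP (conj D0 D1)) (introT andP (conj W0 W1)) hX.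
have a01 : 0 <= 2 * n <= 1 by lra.
have b01 : 0 <= 3/5 * n <= 1 by lra.
have {}S2 := le_trans (S2 _ b01) (S1 _ a01).
have {}hdl : (1 - 2 * n) * dl <= (1 - 2 * n) * (9/2 * mu * x)
    + gamma * (3 - 3/5 * D ^+ 2) * (n * x).
  move: (ler_wpM2l (ltW n2) hdl) => /le_trans; apply.
  rewrite le_eqVlt; apply/orP; left; apply/eqP; rewrite /x; field.
  by rewrite !gt_eqF.
have {}F : 0 <= gamma * x * n ^+ 2 *
   (3/5*(3 - 3/5*W^+2) + X * (3/5 - 2^-1*(1-n)*rho)
    - (1-n)*(4/3*D^+3 - rho^+3/3 + 2^-1*n*rho^+3 + 9/25*rho*W^+2 + 9/125*W^+3)).
  by apply: mulr_ge0 F; apply: mulr_ge0 (sqr_ge0 _); exact: mulr_ge0.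
have hmu1 : (1 - 2 * n) * (9/2 * mu * x) + mu / 2 * (4 * n ^+ 2 + 9/25 * n ^+2) <=
    (1 + 3/5 * n) * (9/2 * mu * n).
  have : 0 <= mu * (9/2 * n * (1 + 3/5 * n) - 9/2 * (1 - 2 * n) * x - 109/50 * n ^+ 2).
    rewrite mulr_ge0 //.
    have : x <= n + 4/3 * n^+2 by nra.
    nra.
  lra.
have hmu2 : mu * n ^+ 2 * D ^+ 2 <= mu * n ^+ 2 * 1.
  by apply: ler_wpM2l; [apply: mulr_ge0 (sqr_ge0 _)|rewrite expr_le1].
have hmu3 : mu * n ^+ 2 * W ^+ 2 <= mu * n ^+ 2 * 1.
  by apply: ler_wpM2l; first exact: mulr_ge0 (sqr_ge0 _).
suff : (1 + 3/5 * n) * dl' <=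
    (1 + 3/5 * n) * (9 / 2 * mu * n + gamma * (3 - 3 / 5 * W ^+ 2) * (n * x)).
  by rewrite ler_pM2l //; lra.
have e1 : gamma * x * n ^+ 2 *
   (3/5*(3 - 3/5*W^+2) + X * (3/5 - 2^-1*(1-n)*rho)
    - (1-n)*(4/3*D^+3 - rho^+3/3 + 2^-1*n*rho^+3 + 9/25*rho*W^+2 + 9/125*W^+3))
  = gamma * (n * x) * (3/5 * n * (3 - 3/5*W^+2) + 3/5 * (D ^+ 2 - W ^+ 2))
   - gamma * n ^+ 2 * (x * (1 - n)) *
     (4/3*D^+3 - rho^+3/3 + 2^-1*n*rho^+3 + 9/25*rho*W^+2 + 9/125*W^+3 + 2^-1 * X * rho).
  by rewrite eX; ring.
rewrite e1 ex in F.
have e2 : gamma * n ^+ 2 * n *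
   (4/3*D^+3 - rho^+3/3 + 2^-1*n*rho^+3 + 9/25*rho*W^+2 + 9/125*W^+3 + 2^-1 * X * rho)
 = gamma * ((2 * n) ^+ 3 * D ^+ 3 / 6 - r ^+ 3 / 3
     + r * (2 * n) * ((D ^+ 2 + r ^+ 2 - W ^+ 2) / 2) / 2)
   + gamma * (r * (3/5 * n) ^+ 2 * W ^+ 2 + (3/5 * n) ^+ 3 * W ^+ 3 / 3).
  have -> : D ^+ 2 + r ^+ 2 - W ^+ 2 = n * X + r ^+ 2 by rewrite -eX; ring.
  by rewrite er; field.
rewrite e2 in F.
move: F S2 hdl hmu1 hmu2 hmu3; clear; clearbody x; lra.
Qed.

(** * Step size and level set *)

Lemma alpha_barP (R : realType) (lambda mu gamma rad : R) :
  0 < lambda -> 0 <= mu -> 0 <= gamma -> 0 < rad ->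
  let A := alpha_bar lambda mu gamma rad in
  [/\ 0 < A <= 3^-1, 6 * mu * A <= lambda & gamma * rad * A ^+ 2 <= 2 * lambda].
Proof.
move=> l0 mu0 g0 rad0 /=.
have gr0 : 0 <= gamma * rad by rewrite mulr_ge0 // ltW.
rewrite /alpha_bar.
set e2 := (lambda%:E / _)%E; set e3 := sqrte _.
have e2E : e2 = if mu == 0 then +oo%E else (lambda / (6 * mu))%:E.
  rewrite /e2 inver mulf_eq0 pnatr_eq0 /=; case: eqP => [_|_]; last by rewrite -EFinM.
  by rewrite gt0_muley // lte_fin.
have e3E : e3 = if gamma * rad == 0 then +oo%E
    else (Num.sqrt (2 * lambda / (gamma * rad)))%:E.
  rewrite /e3 inver; case: eqP => [_|_]; last by rewrite -EFinM.
  by rewrite gt0_muley // lte_fin mulr_gt0.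
have e2p : (0 < e2)%E.
  rewrite e2E; case: eqVneq => // m0; rewrite lte_fin divr_gt0 // mulr_gt0 //.
  by rewrite lt_neqAle eq_sym m0.
have e3p : (0 < e3)%E.
  rewrite e3E; case: eqVneq => // m0; rewrite lte_fin sqrtr_gt0.
  by apply: divr_gt0; [exact: mulr_gt0|rewrite lt_neqAle eq_sym m0].
set m := Order.min _ _.
have mp : (0 < m)%E by rewrite !lt_min lte_fin invr_gt0 ltr0n e2p e3p.
have m1 : (m <= (3^-1)%:E)%E by rewrite ge_min lexx.
have m2 : (m <= e2)%E by rewrite !ge_min lexx orbT.
have m3 : (m <= e3)%E by rewrite !ge_min lexx !orbT.
have mf : m \is a fin_num.
  by rewrite fin_real // (lt_trans _ mp) ?ltNy0 //= (le_lt_trans m1) // ltry.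
move: m2 m3 mp m1; rewrite -(fineK mf) !lee_fin !lte_fin e2E e3E.
move: (fine m) => A m2 m3 A0 A3; split; first by rewrite A0.
  move: m2; case: eqVneq => [-> _|mn0]; first by rewrite mulr0 mul0r ltW.
  rewrite lee_fin ler_pdivlMr; last by rewrite mulr_gt0 // lt_neqAle eq_sym mn0.
  by rewrite mulrC.
move: m3; case: eqVneq => [-> _|gn0]; first by rewrite mul0r mulr_ge0 // ltW.
have gp : 0 < gamma * rad by rewrite lt_neqAle eq_sym gn0.
rewrite lee_fin -(ler_pXn2r (n := 2)) ?nnegrE ?sqrtr_ge0 ?(ltW A0) //.
rewrite sqr_sqrtr; last by rewrite divr_ge0 // mulr_ge0 // ltW.
by rewrite ler_pdivlMr // mulrC.
Qed.

(** Convexity along the segment to [z], divided by the length of the segment,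
    in the limit of short segments. *)
Lemma strongly_convex_growth (R : realType) n (f : 'rV[R]_n -> R) lambda z :
  strongly_convex lambda f -> is_minimizer f z ->
  forall x, lambda / 2 * enorm (x - z) ^+ 2 <= f x - f z.
Proof.
move=> h zmin x; rewrite -subr_ge0.
apply: (@const_term_ge0 R _ (`|lambda| / 2 * enorm (x - z) ^+ 2)) => s s0.
have [s1|s1] := leP s 1; last first.
  have := zmin x. have := ler_norm lambda. have := normr_ge0 lambda.
  have := sqr_ge0 (enorm (x - z)).
  move: (enorm _ ^+ 2) (f x) (f z) `|lambda| => e fx fz l *.
  have : 0 <= (l - lambda) * e by rewrite mulr_ge0 // subr_ge0.
  have : 0 <= l * e * (s - 1) by rewrite mulr_ge0 ?mulr_ge0 // subr_ge0 ltW.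
  lra.
have hs : 0 <= s <= 1 by rewrite ltW.
have := h x z s hs; have := zmin (s *: x + (1 - s) *: z).
have := sqr_ge0 (enorm (x - z)); have := ler_norm lambda.
move: (enorm _ ^+ 2) (f x) (f z) (f _) `|lambda| => e fx fz f1 l.
move=> hl e0 h1 h2.
rewrite -(pmulr_rge0 _ s0).
have : 0 <= s * (s * ((l - lambda) * e)).
  by rewrite !mulr_ge0 ?subr_ge0 ?(ltW s0).
lra.
Qed.

(** The level set of [x] extends behind the minimizer, so that the distance from
    [x] to [z] is only a part of its diameter. Reflecting a piece of the segment
    from [z] to [x] through [z] changes the values of [f] only at third order,
    because the gradient vanishes at [z]. On the segment, strong convexity keeps
    [f] well below [f x], and the bounds on [gamma] and [A] make the point at
    distance [6/5 * A * enorm (z - x)] behind [z] belong to the level set. *)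
Lemma level_diam_gap (R : realType) n (f : 'rV[R]_n -> R) (gamma lambda rad : R) z x A :
  twice_cont_diff f -> lipschitz_hess gamma f -> is_minimizer f z ->
  0 < lambda -> strongly_convex lambda f -> 0 < A <= 3^-1 ->
  0 <= gamma ->
  gamma * rad * A ^+ 2 <= 2 * lambda -> 0 < enorm (z - x) -> enorm (z - x) <= rad ->
  (forall y, rad < enorm (y - x) -> f x < f y) ->
  enorm (z - x) * (1 + 6/5 * A) <= rad.
Proof.
move=> C2 lip zmin l0 sc /andP[A0 A3] g0 hg D0 Dr far.
rewrite leNgt; apply/negP => hD.
pose l := 6/5 * A.
have l01 : 0 <= l <= 1 by rewrite /l; lra.
have h1 : f x < f (z + l *: (z - x)).
  apply: far; have -> : z + l *: (z - x) - x = (1 + l) *: (z - x).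
    by apply/rowP => j; rewrite !mxE; ring.
  by rewrite enormZ ger0_norm 1?mulrC //; rewrite /l; lra.
have h2 := taylor_le C2 lip z (l *: (z - x)).
have h3 := taylor_ge C2 lip z (- (l *: (z - x))).
rewrite !(grad_min_eq0 C2 lip zmin) quadN enormN addr0 in h2 h3.
have h4 := sc x z l l01.
have e4 : l *: x + (1 - l) *: z = z - l *: (z - x).
  by apply/rowP => j; rewrite !mxE; ring.
rewrite e4 enormBC in h4.
have h5 := strongly_convex_growth sc zmin x; rewrite enormBC in h5.
have e6 : enorm (l *: (z - x)) = l * enorm (z - x).
  by rewrite enormZ ger0_norm //; case/andP: l01.
rewrite e6 in h2 h3.
move: h1 h2 h3 h4 h5 D0 Dr.
move: (quad _ _) (f (z + _)) (f (z - _)) (f x) (f z) (enorm _).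
move=> k f1 f2 fx fz D h1 h2 h3 h4 h5 D0 Dr.
have h6 : (1 - l) * (fx - fz + l * lambda / 2 * D ^+ 2) < gamma / 3 * (l * D) ^+ 3 by lra.
have h7 : 0 <= (1 - l) * (fx - fz - lambda / 2 * D ^+ 2).
  by rewrite mulr_ge0 // subr_ge0 //; case/andP: l01.
have h8 : (1 - l ^+ 2) * (lambda / 2) * D ^+ 2 < gamma / 3 * l ^+ 3 * D ^+ 3 by lra.
have h9 : (1 - l ^+ 2) * (lambda / 2) < gamma / 3 * l ^+ 3 * D.
  have D2 : 0 < D ^+ 2 by rewrite exprn_gt0.
  by rewrite -(ltr_pM2r D2) -[X in _ < X]mulrA -exprS.
have h10 : gamma / 3 * l ^+ 3 * D <= (2 * lambda) * (72/125 * A).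
  have : 0 <= gamma * A ^+ 3 * (rad - D).
    by rewrite mulr_ge0 ?subr_ge0 // mulr_ge0 // exprn_ge0 // ltW.
  have := ler_wpM2l (ltW A0) hg.
  rewrite /l; lra.
have : 0 <= lambda * ((1 - l ^+ 2) / 2 - 144/125 * A).
  rewrite mulr_ge0 ?(ltW l0) // /l; nra.
lra.
Qed.

(** * Runs of the method *)

Section Run.
Context {R : realType} {n : nat} (f : 'rV[R]_n -> R) (gamma mu_u rad : R).
Context (mu : nat -> R) (H : nat -> 'M[R]_n) (x : nat -> 'rV[R]_n) (xs : 'rV[R]_n).
Hypothesis f_C2 : twice_cont_diff f.
Hypothesis f_lip : lipschitz_hess gamma f.
Hypothesis xs_min : is_minimizer f xs.
Hypothesis x_INCR : INCR f (fun=> gamma) H x.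
Hypothesis H_approx : forall t : nat,
  loewner_le 0 (H t - hess f (x t)) /\ loewner_le (H t - hess f (x t)) (mu t)%:M.
Hypothesis mu_u_ge0 : 0 <= mu_u.
Hypothesis mu_bound : forall t : nat, 0 <= mu t <= mu_u.
Hypothesis rad_gt0 : 0 < rad.
Hypothesis level_diam : forall y y' : 'rV[R]_n,
  f y <= f (x 0%N) -> f y' <= f (x 0%N) -> enorm (y - y') <= rad.

Let gap t := f (x t) - f xs.
Let dist t := enorm (xs - x t).
Let len t := enorm (x t.+1 - x t).
Let model_gap t := cubic_model f gamma (H t) (x t) (x t.+1) - f xs.
Let proj t := (dist t ^+ 2 + len t ^+ 2 - dist t.+1 ^+ 2) / 2.

Lemma INCR_reg_ge0 : 0 <= gamma. Proof. by have [] := x_INCR 0. Qed.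

Lemma hess_le_approx t v : quad (hess f (x t)) v <= quad (H t) v.
Proof.
have [/(_ v) + _] := H_approx t.
by rewrite subr0 -/(quad _ _) quadB subr_ge0.
Qed.

Lemma approx_le_hess t v : quad (H t) v <= quad (hess f (x t)) v + mu_u * enorm v ^+ 2.
Proof.
have [_ /(_ v)] := H_approx t.
rewrite -/(quad _ _) !quadB {1}/quad mul_mx_scalar dotvZl -enorm2.
have /andP[_ /(ler_wpM2r (sqr_ge0 (enorm v)))] := mu_bound t.
by move: (quad _ _) (quad _ _) => *; lra.
Qed.

Lemma iterate_stepE t : x t.+1 = x t + (x t.+1 - x t).
Proof. by rewrite addrC subrK. Qed.

(** The component of the step along the direction of the minimizer is recorded
    by the distances alone; this is what allows a potential in [dist]. *)
Lemma dotv_projE t : dotv (x t.+1 - x t) (xs - x t) = proj t.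
Proof.
rewrite /proj /dist /len.
have -> : xs - x t.+1 = (xs - x t) - (x t.+1 - x t).
  by rewrite opprB addrA subrK.
rewrite !enorm2; move: (xs - x t) (x t.+1 - x t) => u d.
rewrite !dotvDl !dotvDr !(dotvNl, dotvNr) (dotvC u d).
by move: (dotv _ _) (dotv _ _) (dotv _ _) => *; field.
Qed.

Lemma dist_step t : (dist t - len t) ^+ 2 <= dist t.+1 ^+ 2.
Proof.
have := dotv_le (x t.+1 - x t) (xs - x t); rewrite dotv_projE /proj -/(len t) -/(dist t).
by move: (dist t) (len t) (dist t.+1) => *; lra.
Qed.

Lemma gap_ge0 t : 0 <= gap t. Proof. by rewrite subr_ge0. Qed.

Section Convex.
Context (lambda : R).
Hypothesis lambda_ge0 : 0 <= lambda.
Hypothesis f_sc : strongly_convex lambda f.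

Lemma model_gap_le t a : 0 <= a <= 1 -> model_gap t <= (1 - a) * gap t
   - a * (1 - a) * lambda / 2 * dist t ^+ 2 + mu_u / 2 * a ^+ 2 * dist t ^+ 2
   + gamma * (a ^+ 3 * dist t ^+ 3 / 6 - len t ^+ 3 / 3 + len t * a * proj t / 2).
Proof.
move=> ha; have [_ Hs xmin] := x_INCR t; rewrite iterate_stepE in xmin.
have := model_step_le f_C2 f_lip INCR_reg_ge0 lambda_ge0 f_sc xs Hs
  (hess_le_approx t) (approx_le_hess t) xmin ha.
rewrite -iterate_stepE dotv_projE -/(dist t) -/(len t) /model_gap /gap.
move: (dist t) (len t) (proj t) (cubic_model _ _ _ _ _) (f _) (f _) => *; lra.
Qed.

Lemma model_gap_ge t b : 0 <= b <= 1 -> 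
  gap t.+1 + b * gap t.+1 + b * lambda / 2 * dist t.+1 ^+ 2
   - mu_u / 2 * b ^+ 2 * dist t.+1 ^+ 2
   - gamma * (len t * b ^+ 2 * dist t.+1 ^+ 2 + b ^+ 3 * dist t.+1 ^+ 3 / 3) <= model_gap t.
Proof.
move=> hb; have [_ Hs xmin] := x_INCR t; rewrite iterate_stepE in xmin.
have := model_step_ge f_C2 f_lip INCR_reg_ge0 f_sc xs Hs
  (hess_le_approx t) (approx_le_hess t) xmin hb.
rewrite -iterate_stepE -/(dist t.+1) -/(len t) /model_gap /gap.
move: (dist t.+1) (len t) (cubic_model _ _ _ _ _) (f _) (f _) => *; lra.
Qed.

End Convex.

Lemma model_gap_le_gap t :
  model_gap t <= gap t.+1 + mu_u / 2 * len t ^+ 2 + gamma / 3 * len t ^+ 3.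
Proof.
have := cubic_model_le_f f_C2 f_lip (approx_le_hess t) (x t.+1 - x t).
rewrite -iterate_stepE -/(len t) /model_gap /gap.
move: (len t) (cubic_model _ _ _ _ _) (f _) (f _) => *; lra.
Qed.

Lemma f_iterate_le t : f (x t) <= f (x 0%N).
Proof.
elim: t => // t; apply: le_trans.
have [_ _ xmin] := x_INCR t.
have := f_le_cubic_model f_C2 f_lip (hess_le_approx t) (x t.+1 - x t).
rewrite -iterate_stepE => /le_trans; apply.
apply: (le_trans (xmin (x t))); rewrite -[X in cubic_model _ _ _ _ X]addr0 cubic_modelE.
by rewrite /quad /dotv /enorm /dotv trmx0 !mulmx0 mxE sqrtr0 expr0n mulr0 mul0r !addr0.
Qed.

Lemma dist_le_rad t : dist t <= rad.
Proof. by apply: level_diam; [exact: xs_min|exact: f_iterate_le]. Qed.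

(** If the iterate is already the minimizer the weights cannot be scaled by its
    distance, and the comparison with the full segment ([a = 1]) gives the claim. *)
Lemma linear_rate lambda : 0 < lambda -> strongly_convex lambda f -> forall t,
  gap t.+1 <= (1 - alpha_bar lambda mu_u gamma rad) * gap t.
Proof.
move=> l0 sc t; have l0' := ltW l0.
have [hA hmu hg] := alpha_barP l0 mu_u_ge0 INCR_reg_ge0 rad_gt0.
move: hA hmu hg; set A := alpha_bar _ _ _ _; clearbody A => hA hmu hg.
have := enorm_ge0 (xs - x t); rewrite -/(dist t) le_eqVlt => /orP[/eqP D0|D0].
  have h01 : 0 <= (0 : R) <= 1 by rewrite lexx ler01.
  have h11 : 0 <= (1 : R) <= 1 by rewrite lexx ler01.
  have := model_gap_le l0' sc t h11; have := model_gap_ge sc t h01.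
  have p1 : 0 <= gamma * len t ^+ 3 by rewrite mulr_ge0 ?INCR_reg_ge0 // exprn_ge0 // enorm_ge0.
  have p2 : 0 <= gamma * (len t * dist t.+1 ^+ 2).
    by rewrite mulr_ge0 ?INCR_reg_ge0 // mulr_ge0 ?sqr_ge0 // enorm_ge0.
  have p3 : 0 <= (1 - A) * gap t by rewrite mulr_ge0 ?gap_ge0 //; lra.
  move: p3; rewrite /proj -D0.
  by move: p1 p2; move: (gap t.+1) (model_gap t) (len t) (dist t.+1) (gap t) => *; lra.
have hD := level_diam_gap f_C2 f_lip xs_min l0 sc hA INCR_reg_ge0 hg D0 (dist_le_rad t).
apply: (@contraction_step R A lambda mu_u gamma rad (dist t) (dist t.+1)
  (len t) (proj t) _ _ (model_gap t)) => //.
- exact: INCR_reg_ge0.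
- apply: hD => y hy; rewrite ltNge; apply/negP => fy.
  have := level_diam (le_trans fy (f_iterate_le t)) (f_iterate_le t).
  by rewrite leNgt hy.
- by rewrite enorm_ge0 dist_le_rad.
- exact: enorm_ge0.
- exact: dist_step.
- by move=> a; exact: model_gap_le.
- by move=> b; exact: model_gap_ge.
Qed.

(** Lengths are measured in units of [rad]. At the first step the gap at the
    starting point is unknown, so it is discarded by taking [a = 1]. *)
Lemma sublinear_rate : strongly_convex 0 f -> forall t,
  gap t.+1 <= 9/2 * (mu_u * rad ^+ 2) / (t%:R + 3)
    + gamma * rad ^+ 3 * (3 - 3/5 * (dist t.+1 / rad) ^+ 2) / ((t%:R + 2) * (t%:R + 3)).
Proof.
move=> sc.
pose D t := dist t / rad; pose r t := len t / rad.
have rn : rad != 0 by rewrite gt_eqF.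
have eD t : dist t = rad * D t by rewrite mulrC divfK.
have er t : len t = rad * r t by rewrite mulrC divfK.
have D01 t : 0 <= D t <= 1.
  by rewrite /D divr_ge0 ?enorm_ge0 ?(ltW rad_gt0) //= ler_pdivrMr // mul1r dist_le_rad.
have r0 t : 0 <= r t by rewrite divr_ge0 ?enorm_ge0 ?(ltW rad_gt0).
pose M2 := mu_u * rad ^+ 2; pose G := gamma * rad ^+ 3.
have M20 : 0 <= M2 by rewrite mulr_ge0 // sqr_ge0.
have G0 : 0 <= G by rewrite mulr_ge0 ?INCR_reg_ge0 // exprn_ge0 // ltW.
pose z t := (D t ^+ 2 + r t ^+ 2 - D t.+1 ^+ 2) / 2.
have S1 t a : 0 <= a <= 1 -> model_gap t <= (1 - a) * gap t + M2 / 2 * a ^+ 2 * D t ^+ 2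
   + G * (a ^+ 3 * D t ^+ 3 / 6 - r t ^+ 3 / 3 + r t * a * z t / 2).
  move=> ha; have := model_gap_le (lexx 0) sc t ha; rewrite /proj !eD er /M2 /G /z.
  by move: (D t) (D t.+1) (r t) (model_gap t) (gap t) => *; lra.
have S2 t b : 0 <= b <= 1 -> gap t.+1 + b * gap t.+1
   - M2 / 2 * b ^+ 2 * D t.+1 ^+ 2
   - G * (r t * b ^+ 2 * D t.+1 ^+ 2 + b ^+ 3 * D t.+1 ^+ 3 / 3) <= model_gap t.
  move=> hb; have := model_gap_ge sc t hb; rewrite !eD er /M2 /G.
  by move: (D t.+1) (r t) (model_gap t) (gap t.+1) => *; lra.
have S3 t : model_gap t <= gap t.+1 + M2 / 2 * r t ^+ 2 + G / 3 * r t ^+ 3.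
  have := model_gap_le_gap t; rewrite er /M2 /G.
  by move: (r t) (model_gap t) (gap t.+1) => *; lra.
have geo t : (D t - r t) ^+ 2 <= D t.+1 ^+ 2.
  have := dist_step t; rewrite !eD er -mulrBr !exprMn ler_pM2l // exprn_gt0 //.
rewrite -/M2 -/G; clearbody M2 G.
elim=> [|t IH].
  have h01 : 0 <= (0 : R) <= 1 by rewrite lexx ler01.
  have h11 : 0 <= (1 : R) <= 1 by rewrite lexx ler01.
  have := S1 0 1 h11; have := S2 0 0 h01.
  have /andP[D0 D1] := D01 0; have /andP[W0 W1] := D01 1; have r00 := r0 0.
  rewrite -/(D 1) /z mulr0n !add0r.
  have : 0 <= G * (D 0 ^+ 3 / 6 + r 0 ^+ 3 / 12 - r 0 * D 0 ^+ 2 / 4).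
    rewrite mulr_ge0 //.
    have : 0 <= (r 0 - D 0) ^+ 2 * (r 0 + 2 * D 0).
      by rewrite mulr_ge0 ?sqr_ge0 //; lra.
    lra.
  have : G * (r 0 * D 1 ^+ 2) >= 0 by rewrite mulr_ge0 // mulr_ge0 ?sqr_ge0.
  have : G * D 0 ^+ 3 <= G by rewrite ler_piMr // expr_le1.
  have : M2 * D 0 ^+ 2 <= M2 by rewrite ler_piMr // expr_le1.
  have : G * D 1 ^+ 2 <= G by rewrite ler_piMr // expr_le1.
  move: (gap 0) (gap 1) (model_gap 0) (D 0) (D 1) (r 0) => *. lra.
have t4 : (4 : R) <= t%:R + 4 by rewrite lerDr ler0n.
have hn : 0 < (t%:R + 4 : R)^-1 <= 4^-1.
  by rewrite invr_gt0 lef_pV2 ?posrE ?(lt_le_trans _ t4) //= t4.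
have := @potential_step R _ M2 G _ _ _ _ _ _ _ hn M20 G0 (D01 t.+1) (D01 t.+2) (r0 t.+1)
  (geo t.+1) erefl (S1 t.+1) (S2 t.+1) (S3 t.+1).
rewrite -/(D t.+1) -/(D t.+2) in IH *.
have e1 : (t%:R + 4)^-1 / (1 - (t%:R + 4)^-1) = (t%:R + 3)^-1 :> R by field; lra.
have e2 : (t%:R + 4)^-1 ^+ 2 / ((1 - 2 * (t%:R + 4)^-1) * (1 - (t%:R + 4)^-1))
  = ((t%:R + 2) * (t%:R + 3))^-1 :> R by field; lra.
have e3 : (t%:R + 4)^-1 ^+ 2 / (1 - (t%:R + 4)^-1) = ((t%:R + 3) * (t%:R + 4))^-1 :> R.
  by field; lra.
rewrite e1 e2 e3 => /(_ IH).
have -> : t.+1%:R + 2 = t%:R + 3 :> R by rewrite -natr1; lra.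
by have -> : t.+1%:R + 3 = t%:R + 4 :> R by rewrite -natr1; lra.
Qed.

End Run.

Theorem corollary3 (R : realType) (n : nat) (f : 'rV[R]_n -> R)
    (gamma mu_u rad : R) (mu : nat -> R) (H : nat -> 'M[R]_n)
    (x : nat -> 'rV[R]_n) (xs : 'rV[R]_n)
    (f_C2 : twice_cont_diff f)
    (f_lip : lipschitz_hess gamma f)
    (xs_min : is_minimizer f xs)
    (x_INCR : INCR f (fun=> gamma) H x)
    (H_approx : forall t : nat,
        loewner_le 0 (H t - hess f (x t)) /\
        loewner_le (H t - hess f (x t)) (mu t)%:M)
    (mu_u_ge0 : 0 <= mu_u)
    (mu_bound : forall t : nat, 0 <= mu t <= mu_u)
    (rad_gt0 : 0 < rad)
    (level_diam : forall y y' : 'rV[R]_n,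
        f y <= f (x 0%N) -> f y' <= f (x 0%N) -> enorm (y - y') <= rad) :
  (forall lambda : R, 0 < lambda -> strongly_convex lambda f ->
     forall t : nat,
       f (x t) - f xs <=
         (1 - alpha_bar lambda mu_u gamma rad) ^+ t * (f (x 0%N) - f xs))
  /\
  (strongly_convex 0 f ->
     forall t : nat, (1 <= t)%N ->
       f (x t) - f xs <=
         9 * mu_u * rad ^+ 2 / (2 * (t%:R + 2))
         + 3 * gamma * rad ^+ 3 / ((t%:R + 1) * (t%:R + 2))).
Proof.
split=> [lambda l0 sc t|sc [//|t] _].
  have reg_ge0 : 0 <= gamma by exact: INCR_reg_ge0 x_INCR.
  have [/andP[_ A3] _ _] := alpha_barP l0 mu_u_ge0 reg_ge0 rad_gt0.
  elim: t => [|t IH]; first by rewrite expr0 mul1r.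
  apply: (le_trans (linear_rate f_C2 f_lip xs_min x_INCR H_approx mu_u_ge0
    mu_bound rad_gt0 level_diam l0 sc t)).
  by rewrite exprS -mulrA ler_wpM2l //; lra.
apply: (le_trans (sublinear_rate f_C2 f_lip xs_min x_INCR H_approx mu_u_ge0
  mu_bound rad_gt0 level_diam sc t)).
have reg_ge0 : 0 <= gamma by exact: INCR_reg_ge0 x_INCR.
have t0 : (0 : R) <= t%:R by rewrite ler0n.
have -> : t.+1%:R + 2 = t%:R + 3 :> R by rewrite -natr1; lra.
have -> : t.+1%:R + 1 = t%:R + 2 :> R by rewrite -natr1; lra.
apply: lerD.
  by rewrite le_eqVlt; apply/orP; left; apply/eqP; field; lra.
have p : 0 <= (3/5 : R) by lra.
apply: ler_wpM2r; first by rewrite invr_ge0 mulr_ge0 //; lra.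
have -> : 3 * gamma * rad ^+ 3 = gamma * rad ^+ 3 * 3 by ring.
apply: ler_wpM2l; first by rewrite mulr_ge0 // exprn_ge0 // ltW.
by rewrite gerBl mulr_ge0 ?sqr_ge0.
Qed.
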